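(* Let $\Phi$ be a kernel of finite smoothness on $\mathbb{R}^d$, i.e. for some $\beta>d$ there are constants $c,c_0,c_1>0$ with $c_0\|\omega\|_2^{-\beta}\le\hat\Phi(\omega)\le c_1\|\omega\|_2^{-\beta}$ for $\|\omega\|_2\ge c$. Then every function $f\in\mathcal{H}_\Phi$ has a natural scale: there exists $\epsilon^*>0$ with $\|f\|^2_{\Phi_{\epsilon^*}}=\min_{\epsilon>0}\|f\|^2_{\Phi_\epsilon}$.
   Context: Functions are real-valued and Fourier transformable on $\mathbb{R}^d$. The kernel is a translation-invariant radial positive definite function $\Phi:\mathbb{R}^d\to\mathbb{R}$ with continuous, strictly positive Fourier transform $\hat\Phi$. Its native space $\mathcal{H}_\Phi$ is the reproducing kernel Hilbert space on $\mathbb{R}^d$ with inner product $(f,g)_{\mathcal{H}_\Phi}=(2\pi)^{-d/2}\int_{\mathbb{R}^d}\frac{\hat f(\omega)\overline{\hat g(\omega)}}{\hat\Phi(\omega)}\,d\omega$, consisting of the functions of finite norm. For $\epsilon>0$ the scaled kernel is $\Phi_\epsilon(x)=\Phi(\epsilon x)$, so that $\hat\Phi_\epsilon(\omega)=\epsilon^{-d}\hat\Phi(\omega/\epsilon)$, and $\|f\|_{\Phi_\epsilon}^2=(2\pi)^{-d/2}\int_{\mathbb{R}^d}|\hat f(\omega)|^2/\hat\Phi_\epsilon(\omega)\,d\omega$. An example is the Sobolev space $W_2^m(\mathbb{R}^d)$, $m>d/2$, with $\hat\Phi(\omega)=(1+\|\omega\|_2^2)^{-m}$ and $\beta=2m$.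 *)

(* Defs.v *)
From HB Require Import structures.
From mathcomp Require Import all_boot all_order all_algebra.
From mathcomp Require Import all_classical all_reals all_analysis.
From mathcomp Require Import complex.
Set Implicit Arguments.
Unset Strict Implicit.
Unset Printing Implicit Defensive.
Import Order.TTheory GRing.Theory Num.Theory.
Import numFieldNormedType.Exports.
Local Open Scope classical_set_scope.
Local Open Scope ring_scope.

Section measurable_rV.
Context {d : measure_display} {T : sigmaRingType d}.
Variable n : nat.

Let coord (i : 'I_n) (x : 'rV[T]_n) : T := x ord0 i.

Let rV_set0 : g_sigma_preimage coord set0.
Proof. exact: sigma_algebra0. Qed.

Let rV_setC A : g_sigma_preimage coord A -> g_sigma_preimage coord (~` A).
Proof. exact: sigma_algebraC. Qed.

Let rV_bigcup (F : _^nat) : (forall i, g_sigma_preimage coord (F i)) ->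
  g_sigma_preimage coord (\bigcup_i (F i)).
Proof. exact: sigma_algebra_bigcup. Qed.

(* The sigma-algebra on row vectors generated by the coordinates; on R^n
   this is the Borel sigma-algebra. *)
HB.instance Definition _ := @isMeasurable.Build (measure_tuple_display d)
  'rV[T]_n (g_sigma_preimage coord) rV_set0 rV_setC rV_bigcup.

End measurable_rV.

Section lebesgue_rV.
Context {R : realType}.

Definition consrV n (p : measurableTypeR R * 'rV[R]_n) : 'rV[R]_n.+1 :=
  \row_i oapp (fun j => p.2 ord0 j) p.1 (unlift ord0 i).

Lemma measurable_coord_rV n (i : 'I_n) :
  measurable_fun [set: 'rV[R]_n] (fun x : 'rV[R]_n => x ord0 i).
Proof.
move=> _ Y mY; rewrite setTI; apply: sub_sigma_algebra => /=.
rewrite -bigcup_seq/=; exists i => /=; first by rewrite mem_index_enum.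
by exists Y => //; rewrite setTI.
Qed.

Lemma measurable_fun_rV d (T : measurableType d) n (f : T -> 'rV[R]_n) :
  (forall i, measurable_fun [set: T] (fun x => f x ord0 i)) ->
  measurable_fun [set: T] f.
Proof.
move=> mf _ A mA; rewrite setTI; move: A mA.
suff : g_sigma_preimage (fun (i : 'I_n) (x : 'rV[R]_n) => x ord0 i) `<=`
    [set A | measurable (f @^-1` A)] by exact.
apply: smallest_sub.
  split => /=.
  - by rewrite preimage_set0.
  - move=> A mA; rewrite setTD preimage_setC; exact: measurableC.
  - by move=> F mF; rewrite preimage_bigcup; exact: bigcup_measurable.
rewrite -bigcup_seq => A [i _ [B mB <-]] /=.
by rewrite setTI; have := mf i measurableT B mB; rewrite setTI.
Qed.

Lemma measurable_consrV n : measurable_fun setT (@consrV n).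
Proof.
apply: measurable_fun_rV => i; rewrite /consrV.
have [j ij|i0] := unliftP ord0 i.
- rewrite (_ : (fun _ => _) =
      (fun x : 'rV[R]_n => x ord0 j) \o (@snd (measurableTypeR R) 'rV[R]_n)).
    apply: measurableT_comp; last exact: measurable_snd.
    exact: measurable_coord_rV.
  by apply/funext => p /=; rewrite mxE ij liftK.
- rewrite (_ : (fun _ => _) = (@fst (measurableTypeR R) 'rV[R]_n)).
    exact: measurable_fst.
  by apply/funext => p /=; rewrite mxE i0 unlift_none.
Qed.

Definition unconsrV n (x : 'rV[R]_n.+1) : measurableTypeR R * 'rV[R]_n :=
  (x ord0 ord0, \row_j x ord0 (lift ord0 j)).

Lemma consrVK n : cancel (@consrV n) (@unconsrV n).
Proof.
case=> a x; congr pair => /=; first by rewrite mxE unlift_none.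
by apply/rowP => j; rewrite !mxE liftK.
Qed.

Lemma measurable_unconsrV n : measurable_fun setT (@unconsrV n).
Proof.
apply/measurable_fun_pairP; split; first exact: measurable_coord_rV.
apply: measurable_fun_rV => i.
rewrite (_ : (fun _ => _) = (fun x : 'rV[R]_n.+1 => x ord0 (lift ord0 i))).
  exact: measurable_coord_rV.
by apply/funext => x /=; rewrite mxE.
Qed.

Section step.
Variables (n : nat) (mu : {sigma_finite_measure set 'rV[R]_n -> \bar R}).

Definition lebesgue_rV_step : set 'rV[R]_n.+1 -> \bar R :=
  pushforward (lebesgue_measure \x mu)%E (@consrV n).

Let step0 : lebesgue_rV_step set0 = 0%E.
Proof. by rewrite /lebesgue_rV_step /pushforward preimage_set0 measure0. Qed.

Let step_ge0 A : (0 <= lebesgue_rV_step A)%E.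
Proof. by rewrite /lebesgue_rV_step /pushforward measure_ge0. Qed.

Let step_sigma_additive : semi_sigma_additive lebesgue_rV_step.
Proof.
have mpre A : measurable A -> measurable (@consrV n @^-1` A).
  by move=> mA; rewrite -[X in measurable X]setTI; exact: measurable_consrV.
move=> F mF tF mUF; rewrite /lebesgue_rV_step /pushforward preimage_bigcup.
apply: measure_semi_sigma_additive.
- by move=> k; exact: mpre.
- apply/trivIsetP => /= i j _ _ ij; rewrite -preimage_setI.
  by move/trivIsetP : tF => /(_ _ _ _ _ ij) ->//; rewrite preimage_set0.
- by rewrite -preimage_bigcup; exact: mpre.
Qed.

HB.instance Definition _ := isMeasure.Build _ _ _ lebesgue_rV_step
  step0 step_ge0 step_sigma_additive.

Let sigma_finite_step : sigma_finite setT lebesgue_rV_step.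
Proof.
have mpre A : measurable A -> measurable (@unconsrV n @^-1` A).
  by move=> mA; rewrite -[X in measurable X]setTI; exact: measurable_unconsrV.
have /sigma_finiteP[F [FT ndF mF]] := sigma_finiteT (@lebesgue_measure R).
have /sigma_finiteP[G [GT ndG mG]] := sigma_finiteT mu.
exists (fun k => @unconsrV n @^-1` (F k `*` G k)).
  rewrite -preimage_bigcup [X in _ @^-1` X](_ : _ = setT) ?preimage_setT//.
  apply/seteqP; split => // -[a x] _.
  have [i _ Fia] : (\bigcup_i F i) a by rewrite -FT.
  have [j _ Gjx] : (\bigcup_i G i) x by rewrite -GT.
  exists (maxn i j) => //; split => /=.
  - by move: a Fia; exact/subsetPset/ndF/leq_maxl.
  - by move: x Gjx; exact/subsetPset/ndG/leq_maxr.
move=> k; have [mFk Fk] := mF k; have [mGk Gk] := mG k.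
split; first by apply: mpre; exact: measurableX.
rewrite /lebesgue_rV_step /pushforward -comp_preimage.
rewrite (_ : _ \o _ = id); last by apply/funext => p; exact: consrVK.
by rewrite preimage_id product_measure1E// lte_mul_pinfty// ge0_fin_numE.
Qed.

HB.instance Definition _ := Measure_isSigmaFinite.Build _ _ _
  lebesgue_rV_step sigma_finite_step.

End step.

(* Lebesgue measure on the Borel sets of R^n, as an iterated product *)
Fixpoint lebesgue_rV n : {sigma_finite_measure set 'rV[R]_n -> \bar R} :=
  match n with
  | 0 => \d_(0 : 'rV[R]_0)
  | m.+1 => lebesgue_rV_step (lebesgue_rV m)
  end.

End lebesgue_rV.

Section fourier.
Context {R : realType} {n : nat}.
Implicit Types (f Phi : 'rV[R]_n -> R) (g : 'rV[R]_n -> R[i])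
  (x w : 'rV[R]_n).

(* The norm carried by 'rV[R]_n in the library is the sup norm. *)
Definition eucl x : R := Num.sqrt (\sum_i x ord0 i ^+ 2).

Definition dot x w : R := \sum_i x ord0 i * w ord0 i.

Definition sqnormc (z : R[i]) : R := complex.Re z ^+ 2 + complex.Im z ^+ 2.

(* (2 pi)^(-n/2) \int_(|x| <= r) f x e^(- i x.w) dx, in real and imaginary
   parts. *)
Definition fourier_trunc f (r : R) w : R[i] :=
  Complex
    ((2 * pi) `^ (- (n%:R / 2)) *
       \int[lebesgue_rV n]_(x in [set x | eucl x <= r]) (f x * cos (dot x w)))
    (- ((2 * pi) `^ (- (n%:R / 2)) *
       \int[lebesgue_rV n]_(x in [set x | eucl x <= r]) (f x * sin (dot x w)))).

(* f and g are square integrable and g is the Fourier-Plancherel transform of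
   f, that is the L^2-limit of the truncated Fourier integrals; g is determined
   up to a null set, and agrees a.e. with the usual integral if f is also
   integrable. *)
Definition is_fourier f g : Prop :=
  [/\ measurable_fun setT f /\
        (\int[lebesgue_rV n]_x (f x ^+ 2)%:E < +oo)%E,
      measurable_fun setT (fun w => complex.Re (g w)) /\
        measurable_fun setT (fun w => complex.Im (g w)),
      (\int[lebesgue_rV n]_w (sqnormc (g w))%:E < +oo)%E &
      (\int[lebesgue_rV n]_w (sqnormc (fourier_trunc f r w - g w))%:E)%E
        @[r --> +oo] --> 0%E].

Definition fourier_transformable f : Prop := exists g, is_fourier f g.

Definition continuousC g : Prop :=
  continuous (fun w => complex.Re (g w)) /\
  continuous (fun w => complex.Im (g w)).

(* The representative of the Fourier transform: the continuous one if there is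
   one (it is then unique), and an arbitrary one otherwise. *)
Definition fourier f : 'rV[R]_n -> R[i] :=
  xget (xget (fun=> 0) [set g | is_fourier f g])
       [set g | is_fourier f g /\ continuousC g].

Definition radial Phi : Prop :=
  exists phi : R -> R, forall x, Phi x = phi (eucl x).

(* Strict, as usual for radial basis functions *)
Definition positive_definite Phi : Prop :=
  forall (N : nat) (X : 'I_N -> 'rV[R]_n) (a : 'I_N -> R),
    injective X -> (exists j, a j != 0) ->
    0 < \sum_(j < N) \sum_(k < N) a j * a k * Phi (X j - X k).

(* The translation-invariant kernel is K(x, y) = Phi (x - y). In R[i], [0 < z]
   means that z is real and positive. *)
Definition is_kernel Phi : Prop :=
  [/\ radial Phi, positive_definite Phi, fourier_transformable Phi,
      continuousC (fourier Phi) & forall w, 0 < fourier Phi w].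

(* The squared norm of a Fourier transformable f; +oo is allowed, and the value
   does not depend on the representative chosen for the transform. *)
Definition native_norm2 Phi f : \bar R :=
  (((2 * pi) `^ (- (n%:R / 2)))%:E * \int[lebesgue_rV n]_w
     (sqnormc (fourier f w) / complex.Re (fourier Phi w))%:E)%E.

(* Continuity selects, in the a.e. class determined by the Fourier transform,
   the element of the reproducing kernel Hilbert space. *)
Definition native_space Phi f : Prop :=
  [/\ continuous f, fourier_transformable f & (native_norm2 Phi f < +oo)%E].

Definition scaled (e : R) Phi : 'rV[R]_n -> R := fun x => Phi (e *: x).

Definition finite_smoothness Phi : Prop :=
  exists beta c c0 c1 : R,
    [/\ n%:R < beta, 0 < c, 0 < c0, 0 < c1 &
      forall w, c <= eucl w ->
        c0 * eucl w `^ (- beta) <= complex.Re (fourier Phi w)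
          <= c1 * eucl w `^ (- beta)].

End fourier.

(* Main.v *)
Require Import Defs.
From mathcomp Require Import all_boot all_order all_algebra.
From mathcomp Require Import all_classical all_reals all_analysis.
From mathcomp Require Import measurable_realfun complex ring lra.
Set Implicit Arguments.
Unset Strict Implicit.
Unset Printing Implicit Defensive.
Import Order.TTheory GRing.Theory Num.Theory.
Import numFieldNormedType.Exports.
Local Open Scope classical_set_scope.
Local Open Scope ring_scope.

(** Write P for the (real, positive, continuous) Fourier transform of Phi and
    G = |f^|^2.  The transform of Phi(e x) is e^-n P(w/e), so up to a constant
    factor the squared norm at scale e is the energy

      F(e) = \int G(w) e^n / P(w/e) dw        ([native_norm2_scaled]).

    F(1) is finite because f is in the native space, and F attains its infimum
    on ]0, +oo[ because it is lower semicontinuous and coercive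
    ([attains_min_lsc], by extracting a convergent subsequence from a minimizing
    sequence).

    Lower semicontinuity is Fatou's lemma: the integrand is nonnegative and
    continuous in e for each w.

    Coercivity comes from one constant M with P <= M and P(w) |w|^beta <= M
    everywhere ([decay_bound]); the first bound gives F(e) >= (e^n / M) \int G,
    which grows as e tends to +oo, and the second gives
    F(e) >= (e^(n - beta) / M) \int |w|^beta G, which grows as e tends to 0
    since beta > n.  If either integral vanishes, then G = 0 almost everywhere
    (the origin is a null set), F is identically 0, and every scale is a
    minimizer ([scaled_energy_min]).

    The identification of the norm with F rests on two facts about the
    Fourier-Plancherel transform: it is unique up to null sets
    ([is_fourier_unique]), and it commutes with dilations as expected
    ([is_fourier_scaled]), the latter by the change of variables x -> e x in
    Lebesgue integrals on R^n ([ge0_integral_scale], [integral_scale]). *)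

(** * Dilations and Lebesgue measure on R^n *)

Lemma measurable_scale_rV (R : realType) n (e : R) :
  measurable_fun [set: 'rV[R]_n] (fun x : 'rV[R]_n => e *: x).
Proof.
apply: measurable_fun_rV => i.
rewrite (_ : (fun x => _) = (fun x : 'rV[R]_n => e * x ord0 i)).
  by apply: measurable_funM => //; exact: measurable_coord_rV.
by apply/funext => x; rewrite mxE.
Qed.

(** It suffices to compare both sides on half-open intervals, which determine
    Lebesgue measure. *)
Lemma lebesgue_measure_scale (R : realType) (e : R)
    (A : set (measurableTypeR R)) : 0 < e -> measurable A ->
  (lebesgue_measure
     ((fun x : measurableTypeR R => (e * x)%R : measurableTypeR R) @^-1` A) =
   (e^-1)%:E * lebesgue_measure A)%E.
Proof.
move=> e0 mA.
pose S := fun x : measurableTypeR R => (e * x)%R : measurableTypeR R.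
have mS : measurable_fun setT S by exact: measurable_funM.
have e0' : 0 <= e by exact: ltW.
pose m : measure (measurableTypeR R) R :=
  mscale (NngNum e0') (pushforward lebesgue_measure S).
rewrite [X in (_ * X)%E](@lebesgue_measure_unique _ (m mS)) //; last first.
  move=> _ [[a b] _ <-] /=; rewrite /m /mscale /= /pushforward.
  have -> : S @^-1` `]a, b] = `](a / e), (b / e)]%classic.
    apply/seteqP; split => x /=;
      by rewrite !in_itv /= /S ltr_pdivrMr // ler_pdivlMr // mulrC.
  rewrite !lebesgue_measure_itv /= !lte_fin ltr_pM2r ?invr_gt0 //.
  case: ifPn => _; last by rewrite mule0.
  by rewrite -!EFinB -EFinM -mulrBl mulrCA divff ?mulr1 // gt_eqF.
by rewrite /m /mscale /= muleA -EFinM mulVf ?mul1e // gt_eqF.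
Qed.

(** By induction on the dimension: the dilated product measure, rescaled by
    e^(n+1), agrees with the product measure on rectangles. *)
Lemma lebesgue_rV_scale (R : realType) n (e : R) (A : set 'rV[R]_n) : 0 < e ->
  measurable A ->
  (lebesgue_rV n ((fun x => e *: x)%R @^-1` A) =
   ((e^-1 ^+ n)%R)%:E * lebesgue_rV n A)%E.
Proof.
move=> e0; elim: n A => [|n IH] A mA.
  rewrite expr0 mul1e /=; congr (_ _).
  by apply/seteqP; split => x /=; rewrite [x]thinmx0 scaler0.
pose T (p : measurableTypeR R * 'rV[R]_n) : measurableTypeR R * 'rV[R]_n :=
  (e * p.1, e *: p.2).
have mT : measurable_fun setT T.
  apply/measurable_fun_pairP; split => /=.
    apply: (@measurableT_comp _ _ _ _ _ _
      (fun x : measurableTypeR R => (e * x)%R : measurableTypeR R)).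
      exact: measurable_funM.
    exact: measurable_fst.
  apply: (@measurableT_comp _ _ _ _ _ _ (fun x : 'rV[R]_n => e *: x)).
    exact: measurable_scale_rV.
  exact: measurable_snd.
have e0' : 0 <= e ^+ n.+1 by apply: exprn_ge0; exact: ltW.
pose m : measure (measurableTypeR R * 'rV[R]_n)%type R :=
  mscale (NngNum e0') (pushforward (lebesgue_measure \x lebesgue_rV n)%E T).
rewrite /= /lebesgue_rV_step /pushforward.
have -> : @consrV R n @^-1` ((fun x => e *: x) @^-1` A) =
    T @^-1` (@consrV R n @^-1` A).
  have E p : e *: @consrV R n p = @consrV R n (T p).
    apply/rowP => i; rewrite !mxE /=; case: unliftP => //= j _.
    by rewrite mxE.
  by apply/seteqP; split => p; rewrite /preimage /= E.
have mB : measurable (@consrV R n @^-1` A).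
  by rewrite -[X in measurable X]setTI; exact: measurable_consrV.
set B := _ @^-1` A in mB *.
rewrite [X in (_ * X)%E](@product_measure_unique _ _ _ _ _ _ _ (m mT)) //; last first.
  move=> X Y mX mY; apply/esym.
  rewrite -[LHS]/(lebesgue_measure X * lebesgue_rV n Y)%E.
  rewrite -[RHS]/((e ^+ n.+1)%:E *
    (lebesgue_measure \x lebesgue_rV n)%E (T @^-1` (X `*` Y)))%E.
  have -> : T @^-1` (X `*` Y) =
      ((fun x : measurableTypeR R => (e * x)%R : measurableTypeR R) @^-1` X)
      `*` ((fun x => e *: x) @^-1` Y) by [].
  rewrite product_measure1E; last 2 first.
  - by rewrite -[X in measurable X]setTI; exact: measurable_funM.
  - by rewrite -[X in measurable X]setTI; exact: measurable_scale_rV.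
  rewrite [Y in _ = (_ * (Y * _))%E](_ : _ = (e^-1)%:E * lebesgue_measure X)%E;
    last exact: lebesgue_measure_scale.
  rewrite [Z in _ = (_ * (_ * Z))%E](_ : _ = (e^-1 ^+ n)%:E * lebesgue_rV n Y)%E;
    last exact: IH.
  rewrite muleACA [RHS]muleA -!EFinM.
  have -> : e ^+ n.+1 * (e^-1 * e^-1 ^+ n) = 1.
    by rewrite -(exprS e^-1 n) -exprMn divff ?gt_eqF // expr1n.
  by rewrite mul1e.
rewrite -[X in (_ * X)%E]/((e ^+ n.+1)%:E *
  (lebesgue_measure \x lebesgue_rV n)%E (T @^-1` B))%E.
by rewrite muleA -EFinM -exprMn mulVf ?gt_eqF // expr1n mul1e.
Qed.

Lemma ge0_integral_scale (R : realType) n (e : R) (f : 'rV[R]_n -> \bar R) :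
  0 < e ->
  measurable_fun setT f -> (forall x, 0 <= f x)%E ->
  (\int[lebesgue_rV n]_x f (e *: x)%R =
   ((e^-1 ^+ n)%R)%:E * \int[lebesgue_rV n]_x f x)%E.
Proof.
move=> e0 mf f0.
have mS := @measurable_scale_rV R n e.
pose m : measure _ R := pushforward (lebesgue_rV n) (fun x : 'rV[R]_n => e *: x).
have e0' : 0 <= e^-1 ^+ n by rewrite exprn_ge0 // invr_ge0 ltW.
rewrite -[RHS](@ge0_integral_mscale _ _ _ _ _ _ (NngNum e0')) //.
rewrite -[LHS](@ge0_integral_pushforward _ _ _ _ _ _ mS _ setT) //.
by apply: (@eq_measure_integral _ _ _ _ _ (m mS)) => A mA _;
  rewrite /mscale /= /pushforward lebesgue_rV_scale.
Qed.

(** A positive finite factor distributes over the difference of the integrals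
    of the positive and negative parts even when both are infinite. *)
Lemma integral_scale (R : realType) n (e : R) (f : 'rV[R]_n -> \bar R) :
  0 < e ->
  measurable_fun setT f ->
  (\int[lebesgue_rV n]_x f (e *: x)%R =
   ((e^-1 ^+ n)%R)%:E * \int[lebesgue_rV n]_x f x)%E.
Proof.
move=> e0 mf; rewrite integralE [in RHS]integralE.
have k0 : 0 < e^-1 ^+ n by rewrite exprn_gt0 // invr_gt0.
have -> : (\int[lebesgue_rV n]_x (fun x => f (e *: x)%R)^\+ x =
    (e^-1 ^+ n)%:E * \int[lebesgue_rV n]_x f^\+ x)%E.
  rewrite -ge0_integral_scale //; last exact: measurable_funepos.
  by apply: eq_integral => x _; rewrite !funeposE.
have -> : (\int[lebesgue_rV n]_x (fun x => f (e *: x)%R)^\- x =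
    (e^-1 ^+ n)%:E * \int[lebesgue_rV n]_x f^\- x)%E.
  rewrite -ge0_integral_scale //; last exact: measurable_funeneg.
  by apply: eq_integral => x _; rewrite !funenegE.
have := integral_ge0 (lebesgue_rV n) (D := setT) (fun x _ => funepos_ge0 f x).
have := integral_ge0 (lebesgue_rV n) (D := setT) (fun x _ => funeneg_ge0 f x).
case: (integral _ _ (f^\+)%E) (integral _ _ (f^\-)%E) => [a| |] [b| |] //= _ _;
  rewrite ?gt0_mulye ?gt0_mulNye ?gt0_muley ?gt0_muleNy ?lte_fin //=.
by rewrite -!(EFinM, EFinD) mulrDr mulrN.
Qed.

(** * Dilations and uniqueness of the Fourier-Plancherel transform *)

Lemma measurable_eucl (R : realType) n : measurable_fun setT (@eucl R n).
Proof.
apply: (@measurableT_comp _ _ _ _ _ _ (Num.sqrt : R -> R)).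
  by apply: continuous_measurable_fun; exact: sqrt_continuous.
apply: measurable_sum => i; apply: measurable_funX; exact: measurable_coord_rV.
Qed.

Lemma measurable_eucl_ball (R : realType) n (r : R) :
  measurable [set x : 'rV[R]_n | eucl x <= r].
Proof.
rewrite -[X in measurable X]setTI.
have := @measurable_eucl R n measurableT `]-oo, r]%classic (measurable_itv _).
by congr (measurable (_ `&` _)); apply/seteqP; split => x /=; rewrite in_itv.
Qed.

(** Tonelli's theorem, applied to the positive and negative parts of the
    integrand. *)
Lemma measurable_Rintegral (R : realType) n (h : 'rV[R]_n -> 'rV[R]_n -> R)
    (D : set 'rV[R]_n) : measurable D ->
  measurable_fun setT (fun p : 'rV[R]_n * 'rV[R]_n => h p.1 p.2) ->
  measurable_fun setT (fun w => \int[lebesgue_rV n]_(x in D) h w x).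
Proof.
move=> mD mh.
pose g (p : 'rV[R]_n * 'rV[R]_n) := ((h p.1 \_ D) p.2)%:E.
have mg : measurable_fun setT g.
  apply/measurable_EFinP.
  have -> : (fun p : 'rV[R]_n * 'rV[R]_n => (h p.1 \_ D) p.2) =
      (fun p => h p.1 p.2) \_ (setT `*` D).
    by apply/funext => p; rewrite /patch in_setX /= in_setT.
  apply/(measurable_restrictT _ _).1; first exact: measurableX.
  exact: measurable_funTS.
have -> : (fun w => \int[lebesgue_rV n]_(x in D) h w x) =
    fine \o (fun w =>
      fubini_F (lebesgue_rV n) g^\+ w - fubini_F (lebesgue_rV n) g^\- w)%E.
  apply/funext => w; rewrite Rintegral_mkcond /Rintegral /= integralE.
  by congr (fine (_ - _)); apply: eq_integral => x _; rewrite ?funeposE ?funenegE.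
apply: measurableT_comp; first exact: fine_measurable.
apply: emeasurable_funB.
  apply: measurable_fun_fubini_tonelli_F => //; exact: measurable_funepos.
apply: measurable_fun_fubini_tonelli_F => //; exact: measurable_funeneg.
Qed.

Definition cmeasurable (R : realType) n (g : 'rV[R]_n -> R[i]) : Prop :=
  measurable_fun setT (fun w => complex.Re (g w)) /\
  measurable_fun setT (fun w => complex.Im (g w)).

Lemma measurable_sqnormc (R : realType) n (g : 'rV[R]_n -> R[i]) :
  cmeasurable g -> measurable_fun setT (fun w => (sqnormc (g w))%:E).
Proof.
by case=> mr mi; apply/measurable_EFinP; apply: measurable_funD; exact: measurable_funX.
Qed.

Lemma cmeasurableB (R : realType) n (g h : 'rV[R]_n -> R[i]) :
  cmeasurable g -> cmeasurable h -> cmeasurable (fun w => g w - h w).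
Proof.
move=> [gr gi] [hr hi]; split.
  rewrite (_ : (fun w => _) = (fun w => complex.Re (g w) - complex.Re (h w))).
    exact: measurable_funB.
  by apply/funext => w; case: (g w) (h w) => a b [].
rewrite (_ : (fun w => _) = (fun w => complex.Im (g w) - complex.Im (h w))).
  exact: measurable_funB.
by apply/funext => w; case: (g w) (h w) => a b [].
Qed.

Lemma measurable_dot (R : realType) n :
  measurable_fun setT (fun p : 'rV[R]_n * 'rV[R]_n => dot p.2 p.1).
Proof.
apply: measurable_sum => i; apply: measurable_funM.
  apply: (@measurableT_comp _ _ _ _ _ _ (fun x : 'rV[R]_n => x ord0 i)).
    exact: measurable_coord_rV.
  exact: measurable_snd.
apply: (@measurableT_comp _ _ _ _ _ _ (fun x : 'rV[R]_n => x ord0 i)).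
  exact: measurable_coord_rV.
exact: measurable_fst.
Qed.

Lemma cmeasurable_fourier_trunc (R : realType) n (f : 'rV[R]_n -> R) r :
  measurable_fun setT f -> cmeasurable (fourier_trunc f r).
Proof.
move=> mf.
have mt (t : R -> R) : continuous t ->
    measurable_fun setT (fun w => \int[lebesgue_rV n]_(x in [set x | eucl x <= r])
      (f x * t (dot x w))).
  move=> ct; apply: (@measurable_Rintegral R n (fun w x => f x * t (dot x w))).
    exact: measurable_eucl_ball.
  apply: measurable_funM.
    apply: measurableT_comp; [exact: mf|exact: measurable_snd].
  apply: (@measurableT_comp _ _ _ _ _ _ t); first exact: continuous_measurable_fun.
  exact: measurable_dot.
split => /=; last apply: measurableT_comp => //.
  by apply: measurable_funM => //; apply: mt; exact: continuous_cos.
by apply: measurable_funM => //; apply: mt; exact: continuous_sin.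
Qed.

Lemma dotZZ (R : realType) n (e : R) (x w : 'rV[R]_n) : e != 0 ->
  dot (e *: x) (e^-1 *: w) = dot x w.
Proof.
by move=> e0; apply: eq_bigr => i _; rewrite !mxE mulrACA divff // mul1r.
Qed.

Lemma euclZ (R : realType) n (e : R) (x : 'rV[R]_n) : 0 <= e ->
  eucl (e *: x) = e * eucl x.
Proof.
move=> e0; rewrite /eucl.
under eq_bigr do rewrite mxE exprMn.
by rewrite -mulr_sumr sqrtrM ?sqr_ge0 // sqrtr_sqr ger0_norm.
Qed.

(** The Fourier transform of x |-> f (e x) when g is the transform of f. *)
Definition dilateC (R : realType) n (e : R) (g : 'rV[R]_n -> R[i])
    (w : 'rV[R]_n) : R[i] :=
  Complex (e^-1 ^+ n * complex.Re (g (e^-1 *: w)))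
          (e^-1 ^+ n * complex.Im (g (e^-1 *: w))).

Lemma fourier_trunc_scaled (R : realType) n (e : R) (f : 'rV[R]_n -> R) r :
  0 < e -> measurable_fun setT f ->
  fourier_trunc (scaled e f) r = dilateC e (fourier_trunc f (e * r)).
Proof.
move=> e0 mf; apply/funext => w.
have E (t : R -> R) : continuous t ->
    \int[lebesgue_rV n]_(x in [set x | eucl x <= r]) (scaled e f x * t (dot x w)) =
    e^-1 ^+ n * \int[lebesgue_rV n]_(x in [set x | eucl x <= e * r])
      (f x * t (dot x (e^-1 *: w))).
  move=> ct; rewrite [LHS]Rintegral_mkcond [in RHS]Rintegral_mkcond /Rintegral.
  set h := (fun x => f x * _) \_ _.
  have mh : measurable_fun setT (EFin \o h).
    apply/measurable_EFinP/(measurable_restrictT _ _).1.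
      exact: measurable_eucl_ball.
    apply: measurable_funTS; apply: measurable_funM => //.
    apply: (@measurableT_comp _ _ _ _ _ _ t); first exact: continuous_measurable_fun.
    apply: measurable_sum => i; apply: measurable_funM => //.
    exact: measurable_coord_rV.
  have /= := integral_scale e0 mh.
  have -> : (\int[lebesgue_rV n]_x (h (e *: x))%:E =
    \int[lebesgue_rV n]_x
      (((fun x => scaled e f x * t (dot x w)) \_ [set x | eucl x <= r]) x)%:E)%E.
    apply: eq_integral => x _; rewrite /h /patch.
    have -> : (e *: x \in [set x | eucl x <= e * r]) =
        (x \in [set x | eucl x <= r]).
      by apply/idP/idP; rewrite !inE /= (euclZ _ (ltW e0)) ler_pM2l.
    by rewrite /scaled dotZZ // gt_eqF.
  move=> ->; case: (integral _ _ _) => [a| |] //=.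
  - by rewrite gt0_muley ?lte_fin ?exprn_gt0 ?invr_gt0 //= mulr0.
  - by rewrite gt0_muleNy ?lte_fin ?exprn_gt0 ?invr_gt0 //= mulr0.
rewrite /fourier_trunc /dilateC /= !E; [|exact: continuous_sin|exact: continuous_cos].
by congr Complex; rewrite ?mulrN mulrCA.
Qed.

Lemma cmeasurable_dilateC (R : realType) n (e : R) (g : 'rV[R]_n -> R[i]) :
  cmeasurable g -> cmeasurable (dilateC e g).
Proof.
move=> [mr mi]; split; apply: measurable_funM => //.
  apply: (measurableT_comp mr); exact: measurable_scale_rV.
apply: (measurableT_comp mi); exact: measurable_scale_rV.
Qed.

Lemma integral_sqnormc_dilateC (R : realType) n (e : R) (g : 'rV[R]_n -> R[i]) :
  0 < e -> cmeasurable g ->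
  (\int[lebesgue_rV n]_w (sqnormc (dilateC e g w))%:E =
   (e^-1 ^+ n)%:E * \int[lebesgue_rV n]_w (sqnormc (g w))%:E)%E.
Proof.
move=> e0 mg.
have s0 (z : R[i]) : (0 <= (sqnormc z)%:E)%E by rewrite lee_fin addr_ge0 ?sqr_ge0.
have ei : 0 < e^-1 by rewrite invr_gt0.
transitivity (\int[lebesgue_rV n]_w
  ((e^-1 ^+ n ^+ 2)%:E * (sqnormc (g (e^-1 *: w)))%:E))%E.
  by apply: eq_integral => w _; rewrite -EFinM /sqnormc /= !exprMn mulrDr.
rewrite ge0_integralZl_EFin //; last 2 first.
- apply: (measurableT_comp (measurable_sqnormc mg)); exact: measurable_scale_rV.
- exact: sqr_ge0.
rewrite (@ge0_integral_scale _ _ e^-1 (fun w => (sqnormc (g w))%:E)) //;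
  last exact: measurable_sqnormc.
rewrite muleA -EFinM; congr (_%:E * _)%E.
by rewrite expr2 -mulrA -exprMn divff ?gt_eqF // expr1n mulr1.
Qed.

Lemma is_fourier_cmeasurable (R : realType) n (f : 'rV[R]_n -> R) g :
  is_fourier f g -> cmeasurable g.
Proof. by case. Qed.

(** The change of variables also turns truncation at radius r into truncation at
    radius e r, which tends to +oo with r. *)
Lemma is_fourier_scaled (R : realType) n (e : R) (f : 'rV[R]_n -> R) g :
  0 < e -> is_fourier f g -> is_fourier (scaled e f) (dilateC e g).
Proof.
move=> e0 [[mf f2] mg g2 cg]; split.
- split; first by apply: (measurableT_comp mf); exact: measurable_scale_rV.
  rewrite (@ge0_integral_scale _ _ e (fun x => (f x ^+ 2)%:E)) //.
  + by rewrite lte_mul_pinfty // lee_fin exprn_ge0 // invr_ge0 ltW.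
  + by apply/measurable_EFinP; exact: measurable_funX.
  + by move=> x; rewrite lee_fin sqr_ge0.
- exact: cmeasurable_dilateC.
- rewrite integral_sqnormc_dilateC // lte_mul_pinfty // lee_fin exprn_ge0 //.
  by rewrite invr_ge0 ltW.
have E r : (\int[lebesgue_rV n]_w
  (sqnormc (fourier_trunc (scaled e f) r w - dilateC e g w))%:E =
  (e^-1 ^+ n)%:E * \int[lebesgue_rV n]_w (sqnormc (fourier_trunc f (e * r) w - g w))%:E)%E.
  rewrite fourier_trunc_scaled // -integral_sqnormc_dilateC //; last first.
    by apply: cmeasurableB => //; exact: cmeasurable_fourier_trunc.
  apply: eq_integral => w _; congr (sqnormc _)%:E; rewrite /dilateC.
  case: (fourier_trunc f _ _) (g _) => a b [c d] /=.
  by congr Complex; rewrite mulrBr.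
under eq_cvg do rewrite E.
have H : e * r @[r --> +oo] --> +oo by apply: gt0_cvgMry => //; exact: cvg_id.
have := @cvgeZl _ _ _ _ _ (e^-1 ^+ n)%:E isT (cvg_comp _ _ H cg).
by rewrite mule0.
Qed.

(** The difference of the two sides is |(z - x) + (z - y)|^2. *)
Lemma sqnormcB_le (R : realType) (x y z : R[i]) :
  sqnormc (x - y) <= 2 * sqnormc (z - x) + 2 * sqnormc (z - y).
Proof.
case: x y z => [a b] [c d] [u v]; rewrite /sqnormc /=; rewrite -subr_ge0.
have := sqr_ge0 (u - a + (u - c)); have := sqr_ge0 (v - b + (v - d)); nra.
Qed.

(** Two limits in L^2 of the same truncated integrals are at L^2 distance 0. *)
Lemma is_fourier_unique (R : realType) n (f : 'rV[R]_n -> R) g1 g2 :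
  is_fourier f g1 -> is_fourier f g2 ->
  ae_eq (lebesgue_rV n) setT g1 g2.
Proof.
move=> [[mf _] mg1 _ c1] [_ mg2 _ c2].
have s0 (z : R[i]) : (0 <= (sqnormc z)%:E)%E by rewrite lee_fin addr_ge0 ?sqr_ge0.
have m12 : measurable_fun setT (fun w => (sqnormc (g1 w - g2 w))%:E).
  exact: measurable_sqnormc (cmeasurableB mg1 mg2).
pose J g r := (\int[lebesgue_rV n]_w (sqnormc (fourier_trunc f r w - g w))%:E)%E.
have mJ g r : cmeasurable g ->
    measurable_fun setT (fun w => (sqnormc (fourier_trunc f r w - g w))%:E).
  move=> mg; apply: measurable_sqnormc; apply: cmeasurableB => //.
  exact: cmeasurable_fourier_trunc.
have mJ2 g r : cmeasurable g ->
    measurable_fun setT (fun w => 2%:E * (sqnormc (fourier_trunc f r w - g w))%:E)%E.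
  by move=> mg; apply: emeasurable_funM => //; exact: mJ.
have le r : (\int[lebesgue_rV n]_w (sqnormc (g1 w - g2 w))%:E <=
    2%:E * J g1 r + 2%:E * J g2 r)%E.
  rewrite -!ge0_integralZl_EFin //; try exact: mJ.
  rewrite -ge0_integralD //; try exact: mJ2; try by move=> w _; rewrite mule_ge0.
  apply: ge0_le_integral => //; first by apply: emeasurable_funD; exact: mJ2.
  by move=> w _; rewrite -!EFinM -EFinD lee_fin sqnormcB_le.
have c : (2%:E * J g1 r + 2%:E * J g2 r)%E @[r --> +oo] --> 0%E.
  have h1 := @cvgeZl _ _ _ _ _ 2%:E isT c1; have h2 := @cvgeZl _ _ _ _ _ 2%:E isT c2.
  rewrite mule0 in h1; rewrite mule0 in h2.
  by have := cvgeD _ h1 h2; rewrite adde0; apply.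
have I0 : (\int[lebesgue_rV n]_w (sqnormc (g1 w - g2 w))%:E = 0)%E.
  apply/eqP; rewrite eq_le integral_ge0 ?andbT //.
  by apply: (@cvge_ge _ _ _ _ _ _ _ _ c); apply: nearW => r; exact: le.
have [+ _] := ae_eq_integral_abs (lebesgue_rV n) measurableT m12.
under eq_integral do rewrite gee0_abs //.
move=> /(_ I0); apply: filterS => w /(_ I) /= [].
case: (g1 w) (g2 w) => a b [c' d] /=; rewrite /sqnormc /= => /eqP.
rewrite paddr_eq0 ?sqr_ge0 // !sqrf_eq0 !subr_eq0 => /andP[/eqP -> /eqP ->] _.
by [].
Qed.

(** Both choices made in the definition of [fourier], the continuous one and
    the fallback, are Fourier transforms of f. *)
Lemma fourierP (R : realType) n (f : 'rV[R]_n -> R) :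
  fourier_transformable f -> is_fourier f (fourier f).
Proof.
move=> [g fg]; rewrite /fourier.
case: (xgetP (xget (fun=> 0) [set g | is_fourier f g])
  [set g | is_fourier f g /\ continuousC g]) => [h _ [] // | _].
exact: (xgetI (fun=> 0) fg).
Qed.

(** * Existence of a minimum for lower semicontinuous coercive functions *)

Lemma increasing_seq_cvgny (f : nat -> nat) : increasing_seq f -> f @ \oo --> \oo.
Proof.
move=> incf; apply/cvgnyPge => N; exists N => // k /= Nk.
apply: leq_trans Nk _; elim: k => // k IH; apply: leq_ltn_trans IH _.
by move/increasing_seqP : incf; apply.
Qed.

(** The coercivity hypothesis keeps a minimizing sequence in a compact
    interval [a, b] with a > 0, so Bolzano-Weierstrass gives a subsequence with
    a positive limit, where lower semicontinuity bounds F by its infimum. *)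
Lemma attains_min_lsc (R : realType) (F : R -> \bar R) :
  (forall e, 0 < e -> (0 <= F e)%E) -> (F 1%R < +oo)%E ->
  (forall (u : nat -> R) (l : R), (forall i, 0 < u i) -> 0 < l -> u @ \oo --> l ->
    (F l <= limn_einf (F \o u))%E) ->
  (forall K : R, exists a b : R,
    0 < a /\ forall e, 0 < e -> (F e <= K%:E)%E -> a <= e <= b) ->
  exists2 es, 0 < es & forall e, 0 < e -> (F es <= F e)%E.
Proof.
move=> F0 F1 lscF coerF.
pose S := F @` [set e | 0 < e].
have SF e : 0 < e -> S (F e) by move=> e0; exists e.
have infle e : 0 < e -> (ereal_inf S <= F e)%E by move=> e0; apply: ereal_inf_lbound; exact: SF.
have [m Em] : exists m : R, ereal_inf S = m%:E.
  have : (0 <= ereal_inf S)%E by apply/ereal_infP => _ [e e0 <-]; exact: F0.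
  have : (ereal_inf S < +oo)%E by apply: le_lt_trans F1; exact: infle.
  by case: (ereal_inf S) => // m _ _; exists m.
have S0 : S != set0 by apply/set0P; exists (F 1); exact: SF.
have [v Sv cv] := ereal_inf_seq S0; rewrite Em in cv.
have [N _ vN] : \forall k \near \oo, (v k <= (m + 1)%:E)%E.
  have /fine_cvgP[fv cfv] := cv.
  have lem : \forall k \near \oo, (fine \o v) k <= m + 1.
    by apply: (@cvgr_le _ _ _ _ _ _ cfv); rewrite ltrDl.
  near=> k; have fk : v k \is a fin_num by near: k.
  by rewrite -(fineK fk) lee_fin; near: k.
(* Every term is at most m + 1 once the sequence is shifted by N. *)
have /choice[u uP] : forall k, exists e, 0 < e /\ F e = v (k + N)%N.
  by move=> k; have [e e0 <-] := Sv (k + N)%N; exists e.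
have [a [b [a0 abF]]] := coerF (m + 1).
have uab k : a <= u k <= b.
  have [u0 Fu] := uP k; apply: abF => //; rewrite Fu; apply: vN => /=; exact: leq_addl.
have [f incf cf] : exists2 f : nat -> nat, increasing_seq f & cvgn (u \o f).
  apply: bolzano_weierstrass; exists b; split; first exact: num_real.
  move=> M bM k _ /=; have /andP[ak kb] := uab k.
  by rewrite ger0_norm ?(le_trans kb (ltW bM)) // (le_trans (ltW a0)).
set l := lim (u \o f @ \oo) in cf.
have al : a <= l by apply: limr_ge cf _; apply: nearW => k; case/andP: (uab (f k)).
have l0 : 0 < l by apply: lt_le_trans al.
exists l => // e e0; apply: le_trans (infle _ e0); rewrite Em.
have le := lscF (u \o f) l (fun i => (uP (f i)).1) l0 cf.
apply: le_trans le _.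
have -> : F \o (u \o f) = [sequence v (k + N)%N]_k \o f.
  by apply/funext => k /=; rewrite (uP (f k)).2.
have c : ([sequence v (k + N)%N]_k \o f) @ \oo --> m%:E.
  apply: (@cvg_comp _ _ _ f [sequence v (k + N)%N]_k _ _ _
    (increasing_seq_cvgny incf)).
  by rewrite cvg_shiftn.
by rewrite (cvg_limn_einf_sup c).1.
Unshelve. all: by end_near. Qed.

(** * Bounds on the transform of a kernel of finite smoothness *)

Lemma eucl_ge0 (R : realType) n (x : 'rV[R]_n) : 0 <= eucl x.
Proof. exact: sqrtr_ge0. Qed.

Lemma coord_le_eucl (R : realType) n (x : 'rV[R]_n) i : `|x ord0 i| <= eucl x.
Proof.
rewrite -sqrtr_sqr; apply: ler_wsqrtr; rewrite (bigD1 i) //= lerDl.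
by apply: sumr_ge0 => j _; exact: sqr_ge0.
Qed.

Lemma eucl_le0 (R : realType) n (x : 'rV[R]_n) : eucl x <= 0 -> x = 0.
Proof.
move=> x0; apply/rowP => i; rewrite mxE; apply/eqP.
by rewrite -normr_le0; apply: le_trans x0; exact: coord_le_eucl.
Qed.

(** The origin of R^(n+1) lies in the product of {0} with the origin of R^n,
    and {0} is a null set of R. *)
Lemma lebesgue_rV_set10 (R : realType) n :
  lebesgue_rV n.+1 [set x : 'rV[R]_n.+1 | eucl x <= 0] = 0%E.
Proof.
apply/eqP; rewrite eq_le measure_ge0 andbT.
have m0 : measurable [set x : 'rV[R]_n | eucl x <= 0] by exact: measurable_eucl_ball.
have E : ((@lebesgue_measure R \x lebesgue_rV n)%E
  ([set 0%R] `*` [set x : 'rV[R]_n | (eucl x <= 0)%R]) = 0)%E.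
  rewrite product_measure1E // [X in (X * _)%E](_ : _ = 0%E) ?mul0e //.
  exact: lebesgue_measure_set1.
rewrite -[X in (_ <= X)%E]E /= /lebesgue_rV_step /pushforward.
apply: le_measure; rewrite ?inE.
- rewrite -[X in measurable X]setTI; apply: measurable_consrV => //.
  exact: measurable_eucl_ball.
- by apply: measurableX.
move=> [y x] /= /eucl_le0 yx0.
have := congr1 (@unconsrV R n) yx0; rewrite consrVK /unconsrV => -[-> ->].
split; first by rewrite mxE.
rewrite /= /eucl big1 ?sqrtr0 // => i _; by rewrite !mxE expr0n.
Qed.

(** On the compact cube containing the ball of radius c, P is bounded by
    continuity; outside the ball both bounds follow from the decay. *)
Lemma decay_bound (R : realType) n (P : 'rV[R]_n -> R) (beta c c1 : R) :
  continuous P -> (forall w, 0 < P w) -> 0 < beta -> 0 < c -> 0 < c1 ->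
  (forall w, c <= eucl w -> P w <= c1 * eucl w `^ (- beta)) ->
  exists2 M, 0 < M & forall w, P w <= M /\ P w * eucl w `^ beta <= M.
Proof.
move=> cP P0 b0 c0 c10 dec.
pose K := [set v : 'rV[R]_n | forall i, `[(- c), c]%classic (v ord0 i)].
have cK : compact K by apply: (@rV_compact R n (fun=> `[(- c), c]%classic)) => i; exact: segment_compact.
have K0 : K !=set0.
  by exists 0 => i /=; rewrite mxE in_itv /= oppr_le0 ltW.
have [v0 _ maxK] := EVT_max_rV K0 cK (continuous_subspaceT cP).
have KP w : eucl w <= c -> P w <= P v0.
  move=> wc; apply: maxK; rewrite inE => i /=.
  by rewrite in_itv /= -ler_norml; apply: le_trans wc; exact: coord_le_eucl.
have cb : 0 < c `^ beta by exact: powR_gt0.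
have ci : 0 < (c `^ beta)^-1 by rewrite invr_gt0.
have A w : P w <= P v0 + c1 * (c `^ beta)^-1.
  have [wc|cw] := leP (eucl w) c.
    by rewrite (le_trans (KP _ wc)) // lerDl mulr_ge0 // ltW.
  rewrite (le_trans (dec _ (ltW cw))) // -powRN.
  rewrite (@le_trans _ _ (c1 * c `^ (- beta))) //; last by rewrite lerDr ltW.
  rewrite ler_pM2l // !powRN lef_pV2 ?posrE ?powR_gt0 ?(lt_trans c0 cw) //.
  by apply: ge0_ler_powR; rewrite ?nnegrE ?eucl_ge0 // ltW.
have B w : P w * eucl w `^ beta <= P v0 * c `^ beta + c1.
  have [wc|cw] := leP (eucl w) c.
    rewrite (@le_trans _ _ (P v0 * c `^ beta)) //; last by rewrite lerDl ltW.
    apply: ler_pM; rewrite ?powR_ge0 ?(ltW (P0 _)) ?KP //.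
    by apply: ge0_ler_powR; rewrite ?nnegrE ?eucl_ge0 // ltW.
  have wb : 0 < eucl w `^ beta by rewrite powR_gt0 // (lt_trans c0 cw).
  rewrite (@le_trans _ _ c1) //; last by rewrite lerDr mulr_ge0 // ltW.
  by rewrite -ler_pdivlMr // -powRN; apply: dec; exact: ltW.
exists (P v0 + c1 * (c `^ beta)^-1 + (P v0 * c `^ beta + c1)).
  by rewrite !addr_gt0 ?mulr_gt0.
move=> w; split.
  by rewrite (le_trans (A w)) // lerDl ltW // addr_gt0 ?mulr_gt0.
by rewrite (le_trans (B w)) // lerDr ltW // addr_gt0 ?mulr_gt0.
Qed.

(** * The energy as a function of the scale *)

(** Inversion is not continuous at 0, but 1/x = x (x^2)^(-1) everywhere, with
    the convention 1/0 = 0, and real powers of nonnegative numbers are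
    measurable. *)
Lemma measurable_funV d (T : measurableType d) (R : realType) (g : T -> R) :
  measurable_fun setT g -> measurable_fun setT (fun x => (g x)^-1).
Proof.
move=> mg.
rewrite (_ : (fun x => _) = fun x => g x * (g x ^+ 2) `^ (-1)); last first.
  apply/funext => x; rewrite powR_inv1 ?sqr_ge0 // expr2 invfM mulrA.
  by have [->|g0] := eqVneq (g x) 0; [rewrite invr0 !mulr0|rewrite divff // mul1r].
apply: measurable_funM => //.
apply: (@measurableT_comp _ _ _ _ _ _ (fun y : R => y `^ (-1))).
  exact: measurable_powR.
exact: measurable_funX.
Qed.

Lemma pos_real_below (R : realType) (x : \bar R) : (0 < x)%E ->
  exists2 a : R, 0 < a & (a%:E <= x)%E.
Proof.
case: x => [a| |] //; first by rewrite lte_fin; exists a.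
by exists 1 => //; rewrite leey.
Qed.

Section minimization.
Context {R : realType} {n : nat}.
Variables (G P : 'rV[R]_n.+1 -> R) (beta M : R).
Hypotheses (mG : measurable_fun setT G) (G0 : forall w, 0 <= G w).
Hypotheses (mP : measurable_fun setT P) (cP : continuous P)
  (P0 : forall w, 0 < P w).
Hypotheses (hbeta : n.+1%:R < beta) (M0 : 0 < M).
Hypothesis PM : forall w, P w <= M /\ P w * eucl w `^ beta <= M.

Let density (e : R) (w : 'rV[R]_n.+1) : R :=
  G w / (e^-1 ^+ n.+1 * P (e^-1 *: w)).

Let F (e : R) : \bar R := (\int[lebesgue_rV n.+1]_w (density e w)%:E)%E.

Let weight_gt0 e w : 0 < e -> 0 < e^-1 ^+ n.+1 * P (e^-1 *: w).
Proof. by move=> e0; rewrite mulr_gt0 // exprn_gt0 // invr_gt0. Qed.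

Let density_ge0 e w : 0 < e -> 0 <= density e w.
Proof. by move=> e0; rewrite divr_ge0 // ltW // weight_gt0. Qed.

Let measurable_density e : 0 < e -> measurable_fun setT (EFin \o density e).
Proof.
move=> e0; apply/measurable_EFinP; apply: measurable_funM => //.
apply: measurable_funV; apply: measurable_funM => //.
apply: (measurableT_comp mP); exact: measurable_scale_rV.
Qed.

Let mH : measurable_fun setT (fun w => eucl w `^ beta * G w).
Proof.
apply: measurable_funM => //.
apply: (@measurableT_comp _ _ _ _ _ _ (fun y : R => y `^ beta)).
  exact: measurable_powR.
exact: measurable_eucl.
Qed.

Let A : \bar R := (\int[lebesgue_rV n.+1]_w (G w)%:E)%E.
Let B : \bar R := (\int[lebesgue_rV n.+1]_w (eucl w `^ beta * G w)%:E)%E.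

Let F_ge_large e : 0 < e -> ((e ^+ n.+1 / M)%:E * A <= F e)%E.
Proof.
move=> e0; have k0 : 0 <= e ^+ n.+1 / M by rewrite divr_ge0 // ?exprn_ge0 // ltW.
rewrite /A -ge0_integralZl_EFin //; last 2 first.
- by move=> w _; rewrite lee_fin.
- exact/measurable_EFinP.
apply: ge0_le_integral => //.
- by move=> w _; rewrite -EFinM lee_fin mulr_ge0.
- by apply: emeasurable_funM => //; exact/measurable_EFinP.
- exact: measurable_density.
move=> w _; rewrite -EFinM lee_fin /density mulrC.
apply: ler_wpM2l => //; rewrite exprVn invfM invrK.
apply: ler_pM; rewrite ?invr_ge0 ?exprn_ge0 ?(ltW M0) ?(ltW e0) //.
by rewrite lef_pV2 ?posrE //; case: (PM (e^-1 *: w)).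
Qed.

(** With y = 1/e, the second bound of P at y w reads
    y^beta |w|^beta P(y w) <= M; the density supplies y^(n+1) of the factor
    y^beta, and the bound the rest. *)
Let F_ge_small e : 0 < e -> ((e^-1 `^ (beta - n.+1%:R) / M)%:E * B <= F e)%E.
Proof.
move=> e0; have y0 : 0 < e^-1 by rewrite invr_gt0.
have k0 : 0 <= e^-1 `^ (beta - n.+1%:R) / M by rewrite divr_ge0 // ?powR_ge0 // ltW.
rewrite /B -ge0_integralZl_EFin //; last 2 first.
- by move=> w _; rewrite lee_fin mulr_ge0 // powR_ge0.
- exact/measurable_EFinP.
apply: ge0_le_integral => //.
- by move=> w _; rewrite -EFinM lee_fin mulr_ge0 // mulr_ge0 // powR_ge0.
- by apply: emeasurable_funM => //; exact/measurable_EFinP.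
- exact: measurable_density.
move=> w _; rewrite -EFinM lee_fin /density.
set k := e^-1 `^ _; set W := e^-1 ^+ _ * _; set H := eucl w `^ beta.
have -> : k / M * (H * G w) = G w * (k * H / M) by ring.
apply: ler_wpM2l => //; rewrite -[leRHS]div1r ler_pdivlMr; last exact: weight_gt0.
have -> : k * H / M * W = k * W * H / M by ring.
rewrite ler_pdivrMr // mul1r /k /W /H.
have -> : e^-1 `^ (beta - n.+1%:R) * (e^-1 ^+ n.+1 * P (e^-1 *: w)) * eucl w `^ beta =
    P (e^-1 *: w) * eucl (e^-1 *: w) `^ beta.
  have E : e^-1 `^ beta = e^-1 `^ (beta - n.+1%:R) * e^-1 ^+ n.+1.
    by rewrite -(powR_mulrn n.+1 (ltW y0)) -powRD ?subrK // (gt_eqF y0) implybT.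
  rewrite (euclZ _ (ltW y0)) (powRM _ (ltW y0) (eucl_ge0 w)) E.
  by ring.
by case: (PM (e^-1 *: w)).
Qed.

(** G vanishes almost everywhere off the origin, which is a null set. *)
Let B_eq0 : B = 0%E -> forall e, 0 < e -> F e = 0%E.
Proof.
move=> B0 e e0.
have mB : measurable_fun setT (fun w => (eucl w `^ beta * G w)%:E) by exact/measurable_EFinP.
have [+ _] := ae_eq_integral_abs (lebesgue_rV n.+1) measurableT mB.
under eq_integral do rewrite gee0_abs ?lee_fin ?mulr_ge0 ?powR_ge0 //.
move=> /(_ B0) H.
have Z : \forall w \ae @lebesgue_rV R n.+1, ~ (eucl w <= 0).
  have : (lebesgue_rV n.+1).-negligible [set x : 'rV[R]_n.+1 | eucl x <= 0].
    by apply/negligibleP; [exact: measurable_eucl_ball|exact: lebesgue_rV_set10].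
  by apply: negligibleS => w /= /contrapT.
rewrite /F (@ge0_ae_eq_integral _ _ _ _ _ _ (cst 0%E)) ?integral0 //.
- exact: measurable_density.
- by move=> w _; rewrite lee_fin density_ge0.
move: H Z; apply: filterS2 => w /(_ I) /= -[] /eqP + /negP w0 _.
rewrite mulf_eq0 => /orP[|/eqP Gw].
  by rewrite -ltNge in w0; rewrite gt_eqF // powR_gt0.
by rewrite /density Gw mul0r.
Qed.

Let A_eq0 : A = 0%E -> B = 0%E.
Proof.
move=> A0.
have mA : measurable_fun setT (fun w => (G w)%:E) by exact/measurable_EFinP.
have [+ _] := ae_eq_integral_abs (lebesgue_rV n.+1) measurableT mA.
under eq_integral do rewrite gee0_abs ?lee_fin //.
move=> /(_ A0) H.
rewrite /B (@ge0_ae_eq_integral _ _ _ _ _ _ (cst 0%E)) ?integral0 //.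
- exact/measurable_EFinP.
- by move=> w _; rewrite lee_fin mulr_ge0 // powR_ge0.
by move: H; apply: filterS => w /(_ I) /= -[] -> _; rewrite mulr0.
Qed.

(** Fatou's lemma. *)
Let F_lsc (u : nat -> R) (l : R) : (forall i, 0 < u i) -> 0 < l ->
  u @ \oo --> l -> (F l <= limn_einf (F \o u))%E.
Proof.
move=> u0 l0 ul.
have -> : F l = (\int[lebesgue_rV n.+1]_w
    limn_einf (fun i => (density (u i) w)%:E))%E.
  apply: eq_integral => w _.
  have c : (density (u i) w)%:E @[i --> \oo] --> (density l w)%:E.
    apply: cvg_EFin; first exact: nearW.
    have uV : (u i)^-1 @[i --> \oo] --> l^-1 by apply: cvgV => //; rewrite gt_eqF.
    apply: cvgM; first exact: cvg_cst.
    apply: cvgV; first by rewrite gt_eqF // weight_gt0.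
    apply: cvgM; first exact: (continuous_cvg _ (@exprn_continuous _ n.+1 _)).
    have uVw : (u i)^-1 *: w @[i --> \oo] --> l^-1 *: w.
      by apply: cvgZ => //; exact: cvg_cst.
    apply: (@cvg_comp _ _ _ (fun i => (u i)^-1 *: w) P _ _ _ uVw).
    exact: cP.
  by rewrite (cvg_limn_einf_sup c).1.
apply: fatou => //.
- by move=> i; apply: measurable_density.
- by move=> i w _; rewrite lee_fin density_ge0.
Qed.

(** A bound F(e) <= K turns [F_ge_large] into e^(n+1) <= K M / a' and
    [F_ge_small] into (1/e)^(beta - (n+1)) <= K M / b', where a' and b' are
    positive reals below the two integrals, which may be infinite. *)
Let F_coercive : B != 0%E -> forall K : R, exists a b : R,
  0 < a /\ forall e, 0 < e -> (F e <= K%:E)%E -> a <= e <= b.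
Proof.
move=> B0 K.
have Apos : (0 < A)%E.
  rewrite lt0e integral_ge0 ?andbT; last by move=> w _; rewrite lee_fin.
  by apply: contra_neq B0; exact: A_eq0.
have Bpos : (0 < B)%E.
  by rewrite lt0e B0 integral_ge0 // => w _; rewrite lee_fin mulr_ge0 // powR_ge0.
have [a' a0 aA] := pos_real_below Apos.
have [b' b0 bB] := pos_real_below Bpos.
set gam := beta - n.+1%:R; have gam0 : 0 < gam by rewrite subr_gt0.
(* The maximum with 1 makes T positive, so that its powers are. *)
pose T := Num.max 1 (K * M / b').
have T0 : 0 < T by rewrite lt_max ltr01.
exists (T `^ gam^-1)^-1, (Num.max 1 (K * M / a')).
split; first by rewrite invr_gt0 powR_gt0.
move=> e e0 FK; have y0 : 0 < e^-1 by rewrite invr_gt0.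
have bound k c (X : \bar R) : 0 < k -> (c%:E <= X)%E -> 0 < c ->
    ((k / M)%:E * X <= F e)%E -> k <= K * M / c.
  move=> k0 cX c0 XF; rewrite ler_pdivlMr // -ler_pdivrMr // mulrAC.
  rewrite -lee_fin EFinM; apply: le_trans FK; apply: le_trans XF.
  by apply: lee_wpmul2l => //; rewrite lee_fin divr_ge0 // ltW.
apply/andP; split.
  rewrite -[e]invrK lef_pV2 ?posrE ?powR_gt0 //.
  rewrite -[e^-1](powRr1 (ltW y0)) -(divff (lt0r_neq0 gam0)) powRrM.
  apply: ge0_ler_powR;
    rewrite ?nnegrE ?invr_ge0 ?powR_ge0 ?(ltW gam0) ?(ltW T0) //.
  rewrite le_max; apply/orP; right.
  by apply: bound bB b0 (F_ge_small e0); exact: powR_gt0.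
rewrite le_max; have [//|e1] := leP e 1; apply/orP; right.
apply: (@le_trans _ _ (e ^+ n.+1)).
  by rewrite exprS ler_peMr ?(ltW e0) // exprn_ege1 // ltW.
by apply: bound aA a0 (F_ge_large e0); exact: exprn_gt0.
Qed.

Lemma scaled_energy_min : (F 1 < +oo)%E ->
  exists2 es, 0 < es & forall e, 0 < e -> (F es <= F e)%E.
Proof.
move=> F1; have [B0|B0] := eqVneq B 0%E.
  by exists 1 => // e e0; rewrite !B_eq0.
apply: attains_min_lsc => //; last exact: F_coercive.
by move=> e e0; apply: integral_ge0 => w _; rewrite lee_fin density_ge0.
Qed.

End minimization.

(** * Natural scales *)

(** The representatives of the transform of the scaled kernel may differ from
    the dilated transform of Phi, but only on a null set. *)
Lemma native_norm2_scaled (R : realType) n (Phi f : 'rV[R]_n -> R) e : 0 < e ->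
  fourier_transformable Phi -> (forall w, 0 < complex.Re (fourier Phi w)) ->
  fourier_transformable f ->
  native_norm2 (scaled e Phi) f =
  (((2 * pi) `^ (- (n%:R / 2)))%:E * \int[lebesgue_rV n]_w
     (sqnormc (fourier f w) /
      (e^-1 ^+ n * complex.Re (fourier Phi (e^-1 *: w))))%:E)%E.
Proof.
move=> e0 tPhi P0 tf; congr (_ * _)%E.
have fP := fourierP tPhi; have dP := is_fourier_scaled e0 fP.
have tS : fourier_transformable (scaled e Phi) by exists (dilateC e (fourier Phi)).
have sP := fourierP tS.
have ms := is_fourier_cmeasurable sP; have md := is_fourier_cmeasurable dP.
have mq g : cmeasurable g ->
    measurable_fun setT (fun w => (sqnormc (fourier f w) / complex.Re (g w))%:E).
  move=> [mg _]; apply/measurable_EFinP.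
  apply: measurable_funM; last exact: measurable_funV.
  apply/measurable_EFinP; apply: measurable_sqnormc.
  exact: is_fourier_cmeasurable (fourierP tf).
have ae := is_fourier_unique sP dP.
apply: ae_eq_integral => //.
- exact: (mq _ ms).
- exact: (mq _ md).
by move: ae; apply: filterS => w /(_ I) /= -> _.
Qed.

Theorem mainTheorem5 (R : realType) (d : nat) (hd : (0 < d)%N)
    (Phi : 'rV[R]_d -> R) (hPhi : is_kernel Phi)
    (hsmooth : finite_smoothness Phi)
    (f : 'rV[R]_d -> R) (hf : native_space Phi f) :
  exists2 es : R, 0 < es &
    forall e : R, 0 < e ->
      (native_norm2 (scaled es Phi) f <= native_norm2 (scaled e Phi) f)%E.
Proof.
case: d hd Phi hPhi hsmooth f hf => // n _ Phi hPhi hsmooth f hf.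
have [_ _ tPhi [cP _] P0'] := hPhi.
have P0 w : 0 < complex.Re (fourier Phi w).
  by have := P0' w; rewrite ltcE => /andP[].
have [beta [c [c0 [c1 [hbeta cpos _ c1pos bd]]]]] := hsmooth.
have beta0 : 0 < beta by apply: le_lt_trans hbeta.
have [M M0 PM] := decay_bound cP P0 beta0 cpos c1pos
  (fun w cw => (andP (bd w cw)).2).
have [_ tf nf] := hf.
have [mP _] := is_fourier_cmeasurable (fourierP tPhi).
have C0 : 0 < (2 * pi : R) `^ (- (n.+1%:R / 2)).
  by rewrite powR_gt0 // mulr_gt0 // pi_gt0.
have mG : measurable_fun setT (fun w => sqnormc (fourier f w)).
  apply/measurable_EFinP; apply: measurable_sqnormc.
  exact: is_fourier_cmeasurable (fourierP tf).
have G0 w : 0 <= sqnormc (fourier f w) by rewrite addr_ge0 // sqr_ge0.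
have [|es es0 min] := scaled_energy_min mG G0 mP cP P0 hbeta M0 PM.
  have N1 : (native_norm2 (scaled 1 Phi) f < +oo)%E.
    rewrite (_ : scaled 1 Phi = Phi) //; apply/funext => x.
    by rewrite /scaled scale1r.
  move: N1; rewrite native_norm2_scaled // !ltey; apply: contra_neq => ->.
  by rewrite gt0_muley // lte_fin.
exists es; [exact: es0|move=> e e0].
rewrite (native_norm2_scaled es0 tPhi P0 tf) (native_norm2_scaled e0 tPhi P0 tf).
apply: lee_wpmul2l.
  by rewrite lee_fin ltW.
exact: min.
Qed.
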